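(* For $n\ge0$ let $A_n$ be the set of inversion sequences $e\in\mathbf{I}_n$ having no index $i$ with $e_i>e_{i+1}\le e_{i+2}$. Then $$\sum_{n\ge0}\sum_{e\in A_n}z^nt^{\mathrm{dist}(e)}=\frac{1+z(3-t)-\sqrt{1-z(2+2t-z+6zt-zt^2)}}{4z}.$$
   Context: An inversion sequence of length $n$ is an integer sequence $e=e_1\dots e_n$ with $0\le e_i<i$ for all $i$; $\mathbf{I}_n$ is the set of these, and $\mathbf{I}_0$ consists only of the empty sequence. For $e\in\mathbf{I}_n$, $\mathrm{dist}(e)=|\{e_1,\dots,e_n\}|$ is the number of distinct entries (so $\mathrm{dist}$ of the empty sequence is $0$). In the paper's notation $A_n=\mathbf{I}_n(\underline{>,\leq})$. *)

(* Defs.v *)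
From HB Require Import structures.
From mathcomp Require Import all_boot all_order all_algebra.
From mathcomp Require Import boolp classical_sets.

Set Implicit Arguments.
Unset Strict Implicit.
Unset Printing Implicit Defensive.

Import GRing.Theory.

Local Open Scope ring_scope.

(* Formal power series in one variable z over an integral domain R. *)

Record fps (R : idomainType) := Fps { fps_coef :> nat -> R }.

HB.instance Definition _ (R : idomainType) := gen_eqMixin (fps R).
HB.instance Definition _ (R : idomainType) := gen_choiceMixin (fps R).

Section FpsRing.
Variable R : idomainType.
Implicit Types s t u : fps R.

Lemma fpsP s t : s =1 t -> s = t.
Proof. by case: s t => [f] [g] /= fg; congr Fps; apply/funext. Qed.

Definition fpsC (c : R) : fps R := Fps (fun n => if n == 0%N then c else 0).
Definition fpsX : fps R := Fps (fun n => (n == 1%N)%:R).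

Definition fps_opp s : fps R := Fps (fun n => - s n).
Definition fps_add s t : fps R := Fps (fun n => s n + t n).
Definition fps_mul s t : fps R :=
  Fps (fun n => \sum_(i < n.+1) s i * t (n - i)%N).

Fact fps_addA : associative fps_add.
Proof. by move=> s t u; apply: fpsP => n /=; rewrite addrA. Qed.
Fact fps_addC : commutative fps_add.
Proof. by move=> s t; apply: fpsP => n /=; rewrite addrC. Qed.
Fact fps_add0 : left_id (fpsC 0) fps_add.
Proof. by move=> s; apply: fpsP => n /=; rewrite if_same add0r. Qed.
Fact fps_addN : left_inverse (fpsC 0) fps_opp fps_add.
Proof. by move=> s; apply: fpsP => n /=; rewrite if_same addNr. Qed.

HB.instance Definition _ :=
  GRing.isZmodule.Build (fps R) fps_addA fps_addC fps_add0 fps_addN.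

Local Definition trunc N s : {poly R} := \poly_(i < N) s i.

Local Lemma coef_trunc N s i : (i < N)%N -> (trunc N s)`_i = s i.
Proof. by move=> iN; rewrite coef_poly iN. Qed.

Local Lemma mul_trunc N s t n :
  (n < N)%N -> fps_mul s t n = (trunc N s * trunc N t)`_n.
Proof.
move=> nN; rewrite coefM; apply: eq_bigr => i _.
by rewrite !coef_trunc // (leq_ltn_trans _ nN) ?leq_subr // -ltnS.
Qed.

Fact fps_mulA : associative fps_mul.
Proof.
move=> s t u; apply: fpsP => n.
transitivity ((trunc n.+1 s * (trunc n.+1 t * trunc n.+1 u))`_n).
  rewrite coefM; apply: eq_bigr => i _.
  by rewrite coef_trunc // -mul_trunc // ltnS leq_subr.
rewrite mulrA coefM; apply: eq_bigr => i _.
by rewrite -mul_trunc // coef_trunc // ltnS leq_subr.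
Qed.

Fact fps_mulC : commutative fps_mul.
Proof.
move=> s t; apply: fpsP => n.
by rewrite !(@mul_trunc n.+1) // mulrC.
Qed.

Fact fps_mul1 : left_id (fpsC 1) fps_mul.
Proof.
move=> s; apply: fpsP => n /=.
by rewrite big_ord_recl /= mul1r subn0 big1 ?addr0 // => i _; rewrite mul0r.
Qed.

Fact fps_mulDl : left_distributive fps_mul fps_add.
Proof.
move=> s t u; apply: fpsP => n /=.
by rewrite -big_split; apply: eq_bigr => i _; rewrite mulrDl.
Qed.

Fact fps_oner_neq0 : fpsC 1 != 0.
Proof.
by apply/eqP => /(congr1 (fun s => fps_coef s 0)) /= /eqP; rewrite oner_eq0.
Qed.

HB.instance Definition _ := GRing.Zmodule_isComNzRing.Build (fps R)
  fps_mulA fps_mulC fps_mul1 fps_mulDl fps_oner_neq0.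

Lemma coef_fps0 n : (0 : fps R) n = 0. Proof. exact: if_same. Qed.
Lemma coef_fps1 n : (1 : fps R) n = (n == 0%N)%:R. Proof. by case: n. Qed.
Lemma coef_fpsN s n : (- s) n = - s n. Proof. by []. Qed.
Lemma coef_fpsD s t n : (s + t) n = s n + t n. Proof. by []. Qed.
Lemma coef_fpsM s t n : (s * t) n = \sum_(i < n.+1) s i * t (n - i)%N.
Proof. by []. Qed.

Definition fps_unit : {pred fps R} := fun s => `[< exists t, t * s = 1 >].
Definition fps_inv s : fps R := xget s [set t | t * s = 1].

Fact fps_mulVx : {in fps_unit, left_inverse 1 fps_inv *%R}.
Proof. by move=> s /asboolP [t ts1]; exact: (@xgetPex _ s [set t | t * s = 1] (ex_intro _ t ts1)). Qed.
Fact fps_unitPl s t : t * s = 1 -> fps_unit s.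
Proof. by move=> ts1; apply/asboolP; exists t. Qed.
Fact fps_inv_out : {in [predC fps_unit], fps_inv =1 id}.
Proof.
move=> s /negP nu; rewrite /fps_inv xgetPN // => t ts1.
by case: nu; exact: (fps_unitPl ts1).
Qed.

HB.instance Definition _ := GRing.ComNzRing_hasMulInverse.Build (fps R)
  fps_mulVx fps_unitPl fps_inv_out.

Local Lemma least_coef s : s != 0 ->
  exists2 m, s m != 0 & forall i, (i < m)%N -> s i = 0.
Proof.
move=> s0; have ex : exists m, s m != 0.
  apply: contrapT => no; move/eqP: s0; apply; apply: fpsP => n.
  rewrite coef_fps0; apply/eqP; apply: contrapT => /negP sn.
  by apply: no; exists n.
have [m sm min] := ex_minnP ex; exists m => // i im.
apply/eqP; apply: contraLR im => si; rewrite -leqNgt; exact: min.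
Qed.

Fact fps_idomain : GRing.integral_domain_axiom (fps R).
Proof.
move=> s t st0; apply/negPn/negP; rewrite negb_or.
move=> /andP [/least_coef [m sm ms] /least_coef [n tn nt]].
have := congr1 (fun u => fps_coef u (m + n)%N) st0.
rewrite /= if_same.
rewrite (bigD1 (inord m)) //= inordK ?ltnS ?leq_addr // addKn.
rewrite big1 => [|i im].
  by rewrite addr0 => /eqP; rewrite mulf_eq0 (negPf sm) (negPf tn).
have [lt_im|] := ltnP i m; first by rewrite ms ?mul0r.
rewrite leq_eqVlt => /orP [/eqP mi|lt_mi].
  by case/eqP: im; apply/val_inj; rewrite /= inordK ?ltnS ?leq_addr.
rewrite nt ?mulr0 // ltn_subLR ?ltn_add2r //; first by rewrite -ltnS ltn_ord.
Qed.

HB.instance Definition _ :=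
  GRing.ComUnitRing_isIntegral.Build (fps R) fps_idomain.

(* The branch of the square root with constant term 1; lemmas [fps_sqrtP] and
   [fps_sqrt_uniq] show that it is well defined. *)
Definition fps_sqrt s : fps R :=
  xget 0 [set r : fps R | r 0%N = 1 /\ r ^+ 2 = s].

Section Sqrt.
Hypothesis unit2 : (2%:R : R) \is a GRing.unit.

Local Lemma sqrt_exists s : s 0%N = 1 -> exists r : fps R, r 0%N = 1 /\ r ^+ 2 = s.
Proof.
move=> s0.
suff [r r0 rS] : exists2 r : fps R, r 0%N = 1 & forall n,
    r n.+1 = (s n.+1 - \sum_(k < n) r k.+1 * r (n - k)%N) / 2%:R.
  exists r; split=> //; apply: fpsP => -[|n].
    by rewrite expr2 coef_fpsM big_ord1 r0 mulr1 s0.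
  rewrite expr2 coef_fpsM big_ord_recl big_ord_recr /= subnn subn0 r0.
  under eq_bigr => i _ do rewrite /bump /= add1n subSS.
  rewrite mulr1 mul1r addrCA -mulr2n -mulr_natr rS mulrVK //.
  by rewrite addrC subrK.
pose next (l : seq R) n :=
  (s n.+1 - \sum_(k < n) l`_k.+1 * l`_(n - k)%N) / 2%:R.
pose l := fix l n := if n is m.+1 then rcons (l m) (next (l m) m) else [:: 1].
have sz n : size (l n) = n.+1 by elim: n => //= n IH; rewrite size_rcons IH.
pose r := Fps (fun n => (l n)`_n).
have lE n k : (k <= n)%N -> (l n)`_k = r k.
  elim: n => [|n IH]; first by case: k.
  rewrite leq_eqVlt => /orP [/eqP -> //|kn].
  by rewrite [l n.+1]/= nth_rcons sz kn IH.
exists r => // n.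
rewrite [LHS]/= nth_rcons sz ltnn eqxx /next; congr ((_ - _) / _).
by apply: eq_bigr => k _; rewrite !lE ?leq_subr.
Qed.

Lemma fps_sqrtP s :
  s 0%N = 1 -> fps_sqrt s 0%N = 1 /\ fps_sqrt s ^+ 2 = s.
Proof.
move=> /sqrt_exists.
exact: (@xgetPex _ 0 [set r : fps R | r 0%N = 1 /\ r ^+ 2 = s]).
Qed.

Lemma fps_sqrt_uniq s (r : fps R) : r 0%N = 1 -> r ^+ 2 = s -> r = fps_sqrt s.
Proof.
move=> r0 rs.
have s0 : s 0%N = 1 by rewrite -rs expr2 coef_fpsM big_ord1 r0 mulr1.
have [q0 qs] := fps_sqrtP s0.
have /eqP : r ^+ 2 = fps_sqrt s ^+ 2 by rewrite qs.
rewrite eqf_sqr => /orP [/eqP //|/eqP rq].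
have /eqP := congr1 (fun u => fps_coef u 0%N) rq.
rewrite r0 coef_fpsN q0 -subr_eq0 opprK -[1 + 1]/(2%:R) => /eqP two0.
by move: unit2; rewrite two0 unitr0.
Qed.

End Sqrt.
End FpsRing.

(* Inversion sequences, with indices starting from 0: the condition
   e_i < i (for 1 <= i <= n) becomes e i <= i.  All entries are then < n. *)

Definition inv_seqs (n : nat) : {set {ffun 'I_n -> 'I_n}} :=
  [set e : {ffun 'I_n -> 'I_n} | [forall i, (e i <= i)%N]].

Definition dist (n : nat) (e : {ffun 'I_n -> 'I_n}) : nat :=
  #|[set e i | i : 'I_n]|.

(* Occurrence of the vincular pattern (>, <=) in three consecutive entries. *)
Definition has_gt_le (n : nat) (e : {ffun 'I_n -> 'I_n}) : bool :=
  [exists i : 'I_n, exists j : 'I_n, exists k : 'I_n,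
    [&& j == i.+1 :> nat, k == i.+2 :> nat, (e j < e i)%N & (e j <= e k)%N]].

Definition A (n : nat) : {set {ffun 'I_n -> 'I_n}} :=
  [set e in inv_seqs n | ~~ has_gt_le e].

(* Power series in z with coefficients in Q[t]; quotients by 4z are taken in
   the fraction field of Q[t][[z]], since z is not invertible in Q[t][[z]]. *)

Definition z : fps {poly rat} := fpsX {poly rat}.
Definition t : fps {poly rat} := fpsC ('X : {poly rat}).

(* The sum of z^n t^dist(e) over n >= 0 and e in A_n. *)
Definition A_gf : fps {poly rat} :=
  Fps (fun n => \sum_(e in A n) 'X^(dist e)).

Lemma four_z_neq0 : 4%:R * z != 0.
Proof.
apply/eqP => /(congr1 (fun u => fps_coef u 1%N)) /eqP.
rewrite mulr_natl !mulrS mulr0n !coef_fpsD !coef_fps0 addr0 /=.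
by rewrite -[1%:R + _]/(4%:R : {poly rat}) -polyC_natr polyC_eq0.
Qed.

Lemma two_unit : (2%:R : {poly rat}) \is a GRing.unit.
Proof. by rewrite -polyC_natr poly_unitE coefC size_polyC. Qed.

(* Main.v *)
(* Relax the bound e_i < i to e_i < i + k - 1 (indices from 1), and let G_k be
   the generating function of the nonempty avoiding words with this bound.
   A word without 0 is a shifted word for k - 1; in a word with a positive first
   entry, 0 can occur only once and at the end; and removing a leading 0 gives a
   word for k + 1.  Hence
     G_(k+1) = G_k + z (t G_k + t + G_(k+2) + (t - 1) G_(k+1)),   G_0 = 0.
   The recurrence is homogeneous in 1 + 2 G_k, and its solution is
   1 + 2 G_k = Y^k where Y = 1 + z (t + Y^2 + (t - 1) Y); the required series
   is 1 + G_1 = (1 + Y) / 2. *)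

Require Import Defs.
From mathcomp Require Import all_boot all_order all_algebra.
From mathcomp Require Import ring zify.
Import GRing.Theory.
Local Open Scope ring_scope.

Set Implicit Arguments.
Unset Strict Implicit.
Unset Printing Implicit Defensive.

(** * Words of natural numbers: avoidance, bounds and the placing of zeros *)

Fixpoint avoids (s : seq nat) : bool :=
  if s is x :: s' then
    (if s' is y :: w :: _ then ~~ ((y < x) && (y <= w))%N else true) && avoids s'
  else true.

(** The entry at position [i], counted from 0, is bounded by [i + k]; [k = 1] gives inversion
    sequences. *)
Fixpoint bounded (k : nat) (s : seq nat) : bool :=
  if s is x :: s' then (x < k)%N && bounded k.+1 s' else true.

Definition shift (s : seq nat) : seq nat := map S s.

(** Inverse of deleting a final 0 from an otherwise positive word and lowering the other entries by
    one. *)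
Definition snoc0 (s : seq nat) : seq nat := rcons (shift s) 0%N.

Lemma shift_inj : injective shift.
Proof. exact: inj_map succn_inj. Qed.

Lemma snoc0_inj : injective snoc0.
Proof. by move=> s u /eqP; rewrite eqseq_rcons => /andP [/eqP /shift_inj]. Qed.

Lemma shift_no0 s : 0%N \notin shift s.
Proof. by apply/negP => /mapP []. Qed.

Lemma shiftK s : 0%N \notin s -> shift (map predn s) = s.
Proof.
elim: s => // x s IH; rewrite inE negb_or => /andP [x0 /IH sK].
by rewrite /shift /= -/(shift _) sK prednK // lt0n eq_sym.
Qed.

Lemma avoids_shift s : avoids (shift s) = avoids s.
Proof.
by elim: s => //= x s IH; rewrite -/(shift s) IH; case: (s) => [|y [|w u]].
Qed.

(** The appended 0 could only end an occurrence, but it is strictly below the entry before it. *)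
Lemma avoids_snoc0 s : avoids (snoc0 s) = avoids s.
Proof.
elim: s => //= x s IH; rewrite -/(shift s) -/(snoc0 s) IH.
by case: (s) => [|y [|w u]] //=; rewrite andbF.
Qed.

(** A leading 0 starts no descent. *)
Lemma avoids_cons0 s : avoids (0%N :: s) = avoids s.
Proof. by case: s => [|y [|w s]]. Qed.

Lemma bounded_shift k s : bounded k.+1 (shift s) = bounded k s.
Proof. by elim: s k => //= x s IH k; rewrite IH ltnS. Qed.

Lemma bounded_snoc0 k s : bounded k.+1 (snoc0 s) = bounded k s.
Proof. by elim: s k => //= x s IH k; rewrite -/(shift s) -/(snoc0 s) IH ltnS. Qed.

(* After a descent an avoiding word decreases strictly, so a zero that follows
   a positive first entry can only be the last entry. *)
Lemma avoids_last0 x s :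
  avoids (x.+1 :: s) -> 0%N \in s -> exists u, s = snoc0 u.
Proof.
elim: s x => // -[|y] s IH x /=.
  by case: s {IH} => [|w s] //= _ _; exists [::].
case/andP=> _ av; rewrite inE /= => s0.
by have [u ->] := IH y av s0; exists (y :: u).
Qed.

(** * Enumeration of the bounded avoiding words *)

(* The avoiding words w of length n with w_i < i + k (indices from 0), split
   into those without 0, those starting with a positive entry and containing 0,
   and those starting with 0.  For m = 0 the second family is dropped because
   its only member [:: 0] is already in the third. *)
Fixpoint words (n : nat) : nat -> seq (seq nat) :=
  if n is m.+1 then
    fix words_m k := if k is j.+1 then
        map shift (words_m j)
        ++ (if m == 0%N then [::] else map snoc0 (words m j))
        ++ map (cons 0%N) (words m j.+2)
      else [::]
  else fun=> [:: [::]].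

Lemma wordsSS m k : words m.+1 k.+1 =
  map shift (words m.+1 k)
  ++ (if m == 0%N then [::] else map snoc0 (words m k))
  ++ map (cons 0%N) (words m k.+2).
Proof. by []. Qed.

Arguments words : simpl never.

(** Induction on [n], then on [k]: the recursion lowers [k] at equal length but may raise it at
    smaller length. *)
Lemma mem_words n k s :
  (s \in words n k) = [&& size s == n, bounded k s & avoids s].
Proof.
elim: n k s => [|n IHn] k s; first by case: s.
elim: k s => [|k IHk] s; first by case: s => //= *; rewrite andbF.
rewrite wordsSS !mem_cat.
apply/or3P/and3P => [|[/eqP sz bs av]].
  case.
  - by case/mapP => u; rewrite IHk => /and3P [/eqP <- ? ?] ->;
       rewrite size_map bounded_shift avoids_shift.
  - case: ifP => // n0 /mapP [u]; rewrite IHn => /and3P [/eqP <- ? ?] ->.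
    by rewrite size_rcons size_map bounded_snoc0 avoids_snoc0.
  - case/mapP => u; rewrite IHn => /and3P [/eqP <- bu ?] ->.
    by rewrite avoids_cons0 /= bu.
case: s sz bs av => // -[|x] s [sz] bs av.
  apply: Or33; apply: map_f; rewrite IHn sz eqxx -avoids_cons0 av andbT.
  by case/andP: bs.
have [s0|s0] := boolP (0%N \in s).
  have [u su] := avoids_last0 av s0; apply: Or32.
  have xu : x.+1 :: s = snoc0 (x :: u) by rewrite su.
  have -> : (n == 0%N) = false by rewrite -sz; case: (s) s0.
  rewrite xu; apply: map_f; rewrite IHn -bounded_snoc0 -avoids_snoc0 -xu bs av.
  by rewrite -sz su /= size_rcons size_map eqxx.
have xs : shift (map predn (x.+1 :: s)) = x.+1 :: s.
  by apply: shiftK; rewrite inE.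
apply: Or31; rewrite -xs; apply: map_f.
by rewrite IHk -bounded_shift -avoids_shift xs bs av size_map /= sz eqxx.
Qed.

(** The three families are disjoint: the first has no 0, and of the other two only the third starts
    with 0. *)
Lemma words_uniq n k : uniq (words n k).
Proof.
elim: n k => // n IHn; elim=> // k IHk.
rewrite wordsSS !cat_uniq !map_inj_uniq ?IHk ?IHn /=; first last.
- exact: shift_inj.
- by move=> ? ? [].
rewrite andbT; apply/and3P; split.
- apply/hasPn => s; rewrite mem_cat => sin; apply/negP => /mapP [u _ su].
  have := shift_no0 u; rewrite -su; apply/negP; rewrite negbK.
  case/orP: sin => [|/mapP [v _ ->]]; last by rewrite inE.
  by case: ifP => // _ /mapP [v _ ->]; rewrite mem_rcons inE.
- by case: ifP => // _; rewrite map_inj_uniq //; exact: snoc0_inj.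
- apply/hasPn => _ /mapP [u _ ->]; case: ifPn => // n0; apply/negP.
  case/mapP => -[|x v] //=; rewrite mem_words => /and3P [/eqP sz _ _].
  by rewrite -sz in n0.
Qed.

(** * Weights and the recurrence for the generating functions *)

Definition weight (s : seq nat) : {poly rat} := 'X^(size (undup s)).

Lemma weight_shift s : weight (shift s) = weight s.
Proof. by rewrite /weight /shift undup_map_inj ?size_map //; exact: succn_inj. Qed.

Lemma weight_cons0 s :
  weight (0%N :: s) = (if 0%N \in s then 1 else 'X) * weight s.
Proof. by rewrite /weight /=; case: ifP; rewrite ?mul1r //= exprS. Qed.

(** The number of distinct entries does not depend on where the 0 stands. *)
Lemma weight_snoc0 s : weight (snoc0 s) = 'X * weight s.
Proof.
rewrite -[in RHS]weight_shift -[RHS](_ : weight (0%N :: shift s) = _).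
  by congr ('X^_); apply/eqP; rewrite -uniq_size_uniq ?undup_uniq // => x;
     rewrite !mem_undup mem_rcons.
by rewrite weight_cons0 (negPf (shift_no0 s)).
Qed.

Definition words_gf (k n : nat) : {poly rat} :=
  \sum_(s <- words n k) weight s.

Lemma words_gfS k n : words_gf k.+1 n.+1 =
  words_gf k n.+1 + (if n == 0%N then 0 else 'X * words_gf k n)
  + \sum_(s <- words n k.+2) weight (0%N :: s).
Proof.
rewrite {1}/words_gf wordsSS !big_cat !big_map [LHS]addrA; congr (_ + _ + _).
  by apply: eq_bigr => s _; rewrite weight_shift.
case: ifP => _; rewrite ?big_nil // big_map mulr_sumr.
by apply: eq_bigr => s _; rewrite weight_snoc0.
Qed.

(** Prefixing 0 adds a new value only to the shifted words, which accounts for the term with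
    ['X - 1]. *)
Lemma sum_cons0 k n :
  \sum_(s <- words n.+1 k.+1) weight (0%N :: s) =
  words_gf k.+1 n.+1 + ('X - 1) * words_gf k n.+1.
Proof.
rewrite /words_gf wordsSS !big_cat !big_map /=.
rewrite mulr_sumr addrAC -big_split /=; congr (_ + _).
  apply: eq_bigr => s _.
  by rewrite weight_cons0 (negPf (shift_no0 s)) weight_shift; ring.
congr (_ + _); case: ifP => _; first by rewrite !big_nil.
rewrite !big_map; apply: eq_bigr => s _.
by rewrite weight_cons0 mem_rcons inE mul1r.
Qed.

(** Excluding the empty word makes the series vanish at [k = 0]. *)
Definition nonempty_gf (k : nat) : fps {poly rat} :=
  Fps (fun n => if n == 0%N then 0 else words_gf k n).

Lemma nonempty_gf0 : nonempty_gf 0 = 0.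
Proof. by apply: fpsP => -[|n]; rewrite coef_fps0 //= /words_gf big_nil. Qed.

Lemma coef_zM0 (s : fps {poly rat}) : (z * s) 0%N = 0.
Proof. by rewrite coef_fpsM big_ord1 mul0r. Qed.

Lemma coef_zMS (s : fps {poly rat}) n : (z * s) n.+1 = s n.
Proof.
rewrite coef_fpsM big_ord_recl mul0r add0r big_ord_recl /= subSS subn0 mul1r.
by rewrite big1 ?addr0 // => i _; rewrite mul0r.
Qed.

Lemma coef_CM (c : {poly rat}) s n : (fpsC c * s) n = c * s n.
Proof.
by rewrite coef_fpsM big_ord_recl /= subn0 big1 ?addr0 // => i _; rewrite mul0r.
Qed.

Lemma nonempty_gfS k : nonempty_gf k.+1 =
  nonempty_gf k + z * (t * nonempty_gf k + t + nonempty_gf k.+2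
                       + (t - 1) * nonempty_gf k.+1).
Proof.
apply: fpsP => -[|n]; first by rewrite coef_fpsD coef_zM0 addr0.
rewrite coef_fpsD coef_zMS mulrBl mul1r !(coef_fpsD, coef_fpsN) !coef_CM.
rewrite [LHS]words_gfS [nonempty_gf k n.+1]/=.
(* In length 1 the only word beyond the shifted ones is [[:: 0]]; it gives the summand [t]. *)
case: n => [|n]; first by rewrite /= big_seq1 weight_cons0 /weight /=; ring.
by rewrite sum_cons0 /=; ring.
Qed.

(** * Solution of the recurrence *)

(* If all coefficients below z^n vanish, the recurrence says that the coefficients
   of z^n in E k.+1 and E k agree, so the single initial value E 0 is enough although E k.+2 occurs. *)
Lemma recurrence_eq0 (E : nat -> fps {poly rat}) :
  E 0%N = 0 ->
  (forall k, E k.+1 = E k + z * (t * E k + E k.+2 + (t - 1) * E k.+1)) ->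
  forall k, E k = 0.
Proof.
move=> E0 ES k; apply: fpsP => n; rewrite coef_fps0.
elim: n k => [|n IHn]; elim=> [|k IHk]; rewrite ?E0 ?coef_fps0 //.
  by rewrite ES coef_fpsD coef_zM0 IHk addr0.
rewrite ES coef_fpsD coef_zMS IHk mulrBl mul1r !(coef_fpsD, coef_fpsN).
by rewrite !coef_CM !IHn; ring.
Qed.

Lemma nonempty_gf_exp (Y : fps {poly rat}) k :
  Y = 1 + z * (t + Y ^+ 2 + (t - 1) * Y) -> 1 + 2 * nonempty_gf k = Y ^+ k.
Proof.
move=> YE; apply/eqP; rewrite -subr_eq0; apply/eqP.
(* As [t + 1 + (t - 1) = 2 t], the constant 1 absorbs the summand [t], so the difference of the two
   sides satisfies the homogeneous recurrence. *)
move: k; apply: recurrence_eq0 => [|k].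
  by rewrite nonempty_gf0; ring.
have YS : Y ^+ k.+1 = Y ^+ k * (1 + z * (t + Y ^+ 2 + (t - 1) * Y)).
  by rewrite -YE exprSr.
rewrite {1}nonempty_gfS {1}YS [Y ^+ k.+2](exprD Y 2 k) (exprSr Y k).
ring.
Qed.

(** * Inversion sequences as words *)

Definition word_of n (e : {ffun 'I_n -> 'I_n}) : seq nat :=
  [seq val (e i) | i <- enum 'I_n].

Lemma size_word_of n (e : {ffun 'I_n -> 'I_n}) : size (word_of e) = n.
Proof. by rewrite size_map size_enum_ord. Qed.

Lemma nth_word_of n (e : {ffun 'I_n -> 'I_n}) (i : 'I_n) :
  nth 0%N (word_of e) i = e i.
Proof. by rewrite (nth_map i) ?size_enum_ord // nth_ord_enum. Qed.

Lemma word_of_inj n : injective (@word_of n).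
Proof.
move=> e f ef; apply/ffunP => i; apply: val_inj.
by have := congr1 (nth 0%N ^~ i) ef; rewrite !nth_word_of.
Qed.

Lemma weight_word_of n (e : {ffun 'I_n -> 'I_n}) :
  weight (word_of e) = 'X^(dist e).
Proof.
rewrite /weight /word_of (map_comp val e) undup_map_inj ?size_map; last first.
  exact: val_inj.
congr ('X^_); rewrite -(card_uniqP (undup_uniq _)); apply: eq_card => x.
rewrite mem_undup; apply/mapP/imsetP => -[i _ ->]; exists i => //.
by rewrite mem_enum.
Qed.

Lemma boundedP k s : reflect
  (forall i, (i < size s)%N -> (nth 0%N s i < i + k)%N) (bounded k s).
Proof.
elim: s k => [|x s IH] k /=; first by constructor.
apply: (iffP andP) => [[xk /IH bs] [|i] //= /bs|bs]; first by lia.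
split; first exact: (bs 0%N).
by apply/IH => i /(bs i.+1) /=; lia.
Qed.

Lemma avoidsP s : reflect
  (forall i, (i.+2 < size s)%N ->
     ~~ ((nth 0 s i.+1 < nth 0 s i) && (nth 0 s i.+1 <= nth 0 s i.+2))%N)
  (avoids s).
Proof.
elim: s => [|x s IH] /=; first by constructor.
apply: (iffP andP) => [[h /IH av] [|i] //=|av].
- by case: (s) h => [|y [|w u]].
- exact: av.
split; last by apply/IH => i /(av i.+1).
by case: s av {IH} => [|y [|w u]] // /(_ 0%N); exact.
Qed.

Lemma word_of_mem n (e : {ffun 'I_n -> 'I_n}) :
  (word_of e \in words n 1) = (e \in A n).
Proof.
rewrite mem_words size_word_of eqxx /= !inE; congr (_ && _).
  apply/boundedP/forallP => be i.
    by have := be i; rewrite size_word_of nth_word_of addn1 ltnS; exact.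
  rewrite size_word_of => lt_in.
  by rewrite -[i]/(val (Ordinal lt_in)) nth_word_of addn1 ltnS.
apply/avoidsP/negP => [av /existsP [i /existsP [j /existsP [k]]]|av i].
  case/and4P => /eqP ij /eqP ik eij ejk.
  have := av i; rewrite size_word_of -ik -ij !nth_word_of eij ejk ltn_ord.
  by move/(_ isT).
rewrite size_word_of => lt_in; apply/negP => /andP [e1 e2]; apply: av.
have lt1 := ltnW lt_in; have lt0 := ltnW lt1.
apply/existsP; exists (Ordinal lt0); apply/existsP; exists (Ordinal lt1).
apply/existsP; exists (Ordinal lt_in).
by rewrite -!nth_word_of /= !eqxx e1 e2.
Qed.

Lemma words_word_of n s :
  s \in words n 1 -> exists e : {ffun 'I_n -> 'I_n}, word_of e = s.
Proof.
rewrite mem_words => /and3P [/eqP sz /boundedP bs _].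
(* The default [i] is never taken: the bound puts each entry below [n]. *)
exists [ffun i : 'I_n => insubd i (nth 0%N s i)].
apply: (@eq_from_nth _ 0%N) => [|i]; first by rewrite size_word_of.
rewrite size_word_of => lt_in.
rewrite -[i]/(val (Ordinal lt_in)) nth_word_of ffunE val_insubd.
have := bs i; rewrite sz /= => /(_ lt_in); case: ifP => //; lia.
Qed.

Lemma A_gf_words n : A_gf n = words_gf 1 n.
Proof.
rewrite /= /words_gf; under eq_bigr => e _ do rewrite -weight_word_of.
rewrite -big_enum /= -(big_map (@word_of n) xpredT weight).
apply: perm_big; apply: uniq_perm => [||s].
- by rewrite map_inj_uniq ?enum_uniq //; exact: word_of_inj.
- exact: words_uniq.
apply/mapP/idP => [[e]|sw]; first by rewrite mem_enum -word_of_mem => ? ->.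
have [e es] := words_word_of sw; exists e => //.
by rewrite mem_enum -word_of_mem es.
Qed.

Lemma A_gfE : A_gf = 1 + nonempty_gf 1.
Proof.
apply: fpsP => n; rewrite A_gf_words coef_fpsD coef_fps1.
case: n => [|n] /=; last by rewrite add0r.
by rewrite /words_gf big_seq1 addr0 /weight expr0.
Qed.

(** * The quadratic equation and its power series root *)

Theorem theorem4p21 :
  (tofrac A_gf : {fraction fps {poly rat}}) =
    tofrac (1 + z * (3 - t)
            - fps_sqrt (1 - z * (2 + 2 * t - z + 6 * z * t - z * t ^+ 2)))
    / tofrac (4 * z).
Proof.
set D := (1 - _ * (2 + _ - _ + _ - _)).
have D0 : D 0%N = 1.
  by rewrite coef_fpsD coef_fpsN coef_zM0 coef_fps1 subr0.
have [r0 rD] := fps_sqrtP two_unit D0; set r := fps_sqrt D in r0 rD *.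
(* [D] is the discriminant of the quadratic equation for [Y]. The right side has constant term 0, so
   dividing it by [z] is an index shift. *)
have [Y YE] : exists Y, 2 * z * Y = 1 + z * (1 - t) - r.
  exists (Fps (fun n => 2^-1 * (1 + z * (1 - t) - r) n.+1)).
  have -> : 2 = fpsC (2 : {poly rat}).
    by apply: fpsP => -[|n] /=; rewrite ?addr0.
  rewrite -mulrA.
  apply: fpsP => -[|n]; rewrite coef_CM ?coef_zM0 ?coef_zMS.
    by rewrite !coef_fpsD coef_fpsN coef_zM0 r0 mulr0 coef_fps1 addr0 subrr.
  by rewrite [_ n]/= mulrA divrr ?mul1r ?two_unit.
have rE : r = 1 + z * (1 - t) - 2 * z * Y by rewrite YE; ring.
have Yquad : Y = 1 + z * (t + Y ^+ 2 + (t - 1) * Y).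
  (* Multiplying by [4 z] completes the square: the equation becomes [r ^+ 2 = D]. *)
  apply: (mulfI four_z_neq0); apply/eqP; rewrite -subr_eq0 -(subrr D).
  by rewrite -{2}rD rE /D; apply/eqP; ring.
have := nonempty_gf_exp 1 Yquad; rewrite expr1 => GY.
have nz : tofrac (4 * z) != 0 :> {fraction fps {poly rat}}.
  by rewrite tofrac_eq0 four_z_neq0.
apply: (canRL (mulfK nz)).
rewrite -rmorphM /=; congr tofrac.
by rewrite rE -GY A_gfE; ring.
Qed.
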